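(* Let $X$ be a set with a binary hyperoperation $\star:X\times X\to\mathcal{P}(X)$, an element $1_X\in X$ and a function $(-)':X\to X$. Let $\circledast$ be the induced operation $A\circledast B=\bigcup_{a\in A,\,b\in B}a\star b$ on $\mathcal{P}(X)$, let $e=\{1_X\}$, and extend $(-)'$ to $\mathcal{P}(X)$ by $A'=\{x':x\in A\}$. Then $(X,\star,1_X,(-)')$ is a mosaic if and only if $(\mathcal{P}(X),\circledast,e)$, with the unary operation $(-)'$, is a nonassociative relation algebra.
   Context: $(X,\star,1_X,(-)')$ is a mosaic if: (unital) $x\star 1_X=\{x\}=1_X\star x$ for all $x\in X$; (inverses) $1_X\in(x\star x')\cap(x'\star x)$ for all $x$; (reversible) for all $x,y,z\in X$, $x\in y\star z$ implies $y\in x\star z'$ and $z\in y'\star x$. Associativity is not required. A nonassociative relation algebra is a Boolean algebra $A$ with a binary operation $\circledast$, an atom $e$ with $e\circledast x=x=x\circledast e$ for all $x\in A$, and a unary operation $(-)'$ such that for all $x,y,z\in A$: $$(x\circledast y)\wedge z=\bot \iff (x'\circledast z)\wedge y=\bot\iff (z\circledast y')\wedge x=\bot.$$ *)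

(* Defs.v *)
From mathcomp Require Import all_boot all_order.
From mathcomp Require Import boolp classical_sets.

Set Implicit Arguments.
Unset Strict Implicit.
Unset Printing Implicit Defensive.

Local Open Scope classical_set_scope.

Definition is_mosaic (X : Type) (star : X -> X -> set X) (u : X) (inv : X -> X)
    : Prop :=
  [/\ forall x, star x u = [set x] /\ star u x = [set x],
      forall x, (star x (inv x) `&` star (inv x) x) u
    & forall x y z, star y z x -> star x (inv z) y /\ star (inv y) x z].

Section NonassociativeRelationAlgebra.
Local Open Scope order_scope.

Definition is_atom (d : Order.disp_t) (A : tbPOrderType d) (e : A) : Prop :=
  e != \bot /\ forall x : A, x <= e -> x = \bot \/ x = e.

(* Boolean algebras are the complemented distributive lattices
   [ctbDistrLatticeType]; they may be degenerate in general, but here the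
   existence of the atom [e] rules out the one-element algebra. *)
Definition is_nonassociative_relation_algebra
    (d : Order.disp_t) (A : ctbDistrLatticeType d)
    (op : A -> A -> A) (e : A) (inv : A -> A) : Prop :=
  [/\ is_atom e,
      forall x, op e x = x /\ op x e = x
    & forall x y z,
        (op x y `&` z = \bot <-> op (inv x) z `&` y = \bot) /\
        (op (inv x) z `&` y = \bot <-> op z (inv y) `&` x = \bot)].

End NonassociativeRelationAlgebra.

Definition set_star (X : Type) (star : X -> X -> set X) (A B : set X) : set X :=
  \bigcup_(a in A) \bigcup_(b in B) star a b.

Definition set_inv (X : Type) (inv : X -> X) (A : set X) : set X := inv @` A.

(* Main.v *)
Require Import Defs.
From mathcomp Require Import all_boot all_order boolp classical_sets.

(** Say that [c] is a product of [a] and [b] when [star a b c].  Both sides of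
    the equivalence are statements about this ternary relation.  A triangle
    condition such as [set_star star A B `&` C = set0] says that no product of
    an element of [A] and an element of [B] lies in [C]
    ([set_star_disjointP]), so the relation algebra axiom for arbitrary
    sets is equivalent to its instance for singletons, which reads
    [star a b c <-> star (inv a) c b <-> star c (inv b) a].

    In a mosaic, the forward implications in this chain are reversibility.
    Applying reversibility again would give back [star a b c], but with [inv]
    applied twice to [a] or [b]; so the converses need [inv] to be an
    involution, which follows from the three mosaic axioms together
    ([mosaic_invK]).

    Conversely, the forward implications for singletons are reversibility on
    the nose, and applying them to [star u x x] and [star x u x] gives
    [star x (inv x) u] and [star (inv x) x u], the inverse axiom. *)

Local Open Scope classical_set_scope.

Lemma set_star_disjointP (X : Type) (star : X -> X -> set X) (A B C : set X) :
  set_star star A B `&` C = set0 <->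
  forall a b c, A a -> B b -> C c -> ~ star a b c.
Proof.
split=> [ABC0 a b c Aa Bb Cc abc | noABC].
  suff : (set_star star A B `&` C) c by rewrite ABC0.
  by split=> //; exists a => //; exists b.
by rewrite -subset0 => c [[a Aa [b Bb abc]] Cc]; apply: (noABC a b c).
Qed.

Lemma set_star1 (X : Type) (star : X -> X -> set X) (a b : X) :
  set_star star [set a] [set b] = star a b.
Proof. by rewrite /set_star !bigcup_set1. Qed.

Lemma set_inv1 (X : Type) (inv : X -> X) (a : X) :
  set_inv inv [set a] = [set inv a].
Proof. exact: image_set1. Qed.

Lemma setI1_eq0 (X : Type) (A : set X) (c : X) : A `&` [set c] = set0 <-> ~ A c.
Proof.
rewrite -subset0; split=> [sub0 Ac | nAc x [Ax xc]]; first exact: (sub0 c).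
by apply: nAc; rewrite -xc.
Qed.

Lemma set1_is_atom (X : Type) (u : X) : is_atom [set u].
Proof.
split; first by apply/eqP => u0; have : set0 u by rewrite -[set0]u0.
by move=> A; rewrite subsetEset => /subset_set1.
Qed.

Section Mosaic.
Context {X : Type} {star : X -> X -> set X} {u : X} {inv : X -> X}.
Context (mosaicX : is_mosaic star u inv).

(** Reversing [u \in x * x'] on the right gives [x \in u * x''], and the only
    product of [u] and [x''] is [x'']. *)
Lemma mosaic_invK x : inv (inv x) = x.
Proof.
have [unit invX rev] := mosaicX.
have [xx'u _] := invX x.
have [xE _] := rev _ _ _ xx'u.
by move: xE; rewrite (unit _).2 => /esym.
Qed.

Lemma mosaic_rotatel a b c : star a b c <-> star (inv a) c b.
Proof.
have [_ _ rev] := mosaicX; split=> [/rev[_] // | /rev[_]].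
by rewrite mosaic_invK.
Qed.

Lemma mosaic_rotater a b c : star a b c <-> star c (inv b) a.
Proof.
have [_ _ rev] := mosaicX; split=> [/rev[+ _] // | /rev[+ _]].
by rewrite mosaic_invK.
Qed.

Lemma set_star_unitr A : set_star star A [set u] = A.
Proof.
have [unit _ _] := mosaicX.
rewrite /set_star -[RHS]image_id -bigcup_imset1; apply: eq_bigcupr => a _.
by rewrite bigcup_set1 (unit a).1.
Qed.

Lemma set_star_unitl A : set_star star [set u] A = A.
Proof.
have [unit _ _] := mosaicX.
rewrite /set_star bigcup_set1 -[RHS]image_id -bigcup_imset1.
by apply: eq_bigcupr => a _; rewrite (unit a).2.
Qed.

Lemma set_star_rotatel A B C :
  set_star star A B `&` C = set0 <->
  set_star star (set_inv inv A) C `&` B = set0.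
Proof.
rewrite !set_star_disjointP; split=> [noABC | noA'CB].
  by move=> _ c b [a Aa <-] Cc Bb /(mosaic_rotatel a b c).2; apply: noABC.
move=> a b c Aa Bb Cc /mosaic_rotatel.
by apply: noA'CB => //; exists a.
Qed.

Lemma set_star_rotater A B C :
  set_star star A B `&` C = set0 <->
  set_star star C (set_inv inv B) `&` A = set0.
Proof.
rewrite !set_star_disjointP; split=> [noABC | noCB'A].
  by move=> c _ a Cc [b Bb <-] Aa /(mosaic_rotater a b c).2; apply: noABC.
move=> a b c Aa Bb Cc /mosaic_rotater.
by apply: noCB'A => //; exists b.
Qed.

Lemma mosaic_powerset_algebra :
  is_nonassociative_relation_algebra (set_star star) [set u] (set_inv inv).
Proof.
split; first exact: set1_is_atom.
- by move=> A; rewrite set_star_unitl set_star_unitr.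
- move=> A B C; split; first exact: set_star_rotatel.
  exact: (iff_trans (iff_sym (set_star_rotatel A B C))
                    (set_star_rotater A B C)).
Qed.

End Mosaic.

Lemma powerset_algebra_mosaic (X : Type) (star : X -> X -> set X) (u : X)
    (inv : X -> X) :
  is_nonassociative_relation_algebra (set_star star) [set u] (set_inv inv) ->
  is_mosaic star u inv.
Proof.
case=> _ unitA triangle.
have unit x : star x u = [set x] /\ star u x = [set x].
  by have [] := unitA [set x]; rewrite !set_star1.
have disjoint1 a b c :
    set_star star [set a] [set b] `&` [set c] = set0 <-> ~ star a b c.
  by rewrite set_star1; exact: setI1_eq0.
(* The axiom speaks of empty intersections, so each implication between
   membership statements is the contrapositive of a backward implication. *)
have rotatel a b c : star a b c -> star (inv a) c b.
  have [+ _] := triangle [set a] [set b] [set c].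
  rewrite set_inv1 => -[_ back] abc; apply: contrapT => /disjoint1/back.
  by move/disjoint1.
have rotater a b c : star a b c -> star c (inv b) a.
  have [_ +] := triangle [set a] [set b] [set c].
  rewrite !set_inv1 => -[_ back] /rotatel abc; apply: contrapT.
  by move=> /disjoint1/back/disjoint1.
split=> // [x | x y z yzx]; last by split; [exact: rotater | exact: rotatel].
split; [apply: rotater | apply: rotatel].
- by rewrite (unit x).2.
- by rewrite (unit x).1.
Qed.

Theorem theorem3p8 (X : Type) (star : X -> X -> set X) (u : X) (inv : X -> X) :
  is_mosaic star u inv <->
  is_nonassociative_relation_algebra (set_star star) [set u] (set_inv inv).
Proof.
split; [exact: mosaic_powerset_algebra | exact: powerset_algebra_mosaic].
Qed.
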